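(* Let $n$ be a positive integer. For integers $a,k$ such that $0\leq a\leq k$, $$\mathcal{A}^{(n)}_{(k-a)\bar\Lambda_0+a\bar\Lambda_n}(z)=\sum_{i=0}^a (zq)^i\,\mathcal{A}^{(n)}_{i\bar\Lambda_0+(a-i)\bar\Lambda_1+(k-a)\bar\Lambda_n}(zq).$$ Moreover, for every integer $k\geq 1$, $$\mathcal{A}^{(n)}_{(k-1)\bar\Lambda_0+\bar\Lambda_1}(z)=\mathcal{A}^{(n)}_{\bar\Lambda_{n-1}+(k-1)\bar\Lambda_n}(zq)+(zq^2)^k\mathcal{A}^{(n)}_{k\bar\Lambda_0}(zq^2)+zq\sum_{i=0}^{k-1}(zq^2)^i\,\mathcal{A}^{(n)}_{i\bar\Lambda_0+(k-i)\bar\Lambda_1}(zq^2).$$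
   Context: An $n$-coloured partition $\lambda$ is a finite multiset of parts, each part being a positive integer $i$ (its size) together with one of $n$ colours $c\in\{1,\dots,n\}$ (the order among colours is immaterial). Let $f_i^{(c)}=f_i^{(c)}(\lambda)$ be the multiplicity of parts of size $i\geq 1$ and colour $c$, $|\lambda|=\sum_{i,c}i f_i^{(c)}$ and $l(\lambda)=\sum_{i,c}f_i^{(c)}$. Given nonnegative integers $k_0,\dots,k_n$, extend the frequencies by $f_0^{(c)}:=k_0\delta_{c,1}$ and $f_{-1}^{(c)}:=k_c$ for $1\leq c\leq n$. A path is a sequence $P=(p_1,\dots,p_{2n})$ with $p_{2c-1}=f^{(c)}_{i_{2c-1}}$ and $p_{2c}=f^{(c)}_{i_{2c}}$ for $1\leq c\leq n$, where $i_{2c-1}\in\{0,2,4,\dots\}$, $i_{2c}\in\{-1,1,3,\dots\}$ and $|i_r-i_{r+1}|=1$ for all $1\leq r<2n$. Let $\mathscr{A}_{k_0,\dots,k_n}$ be the set of $n$-coloured partitions $\lambda$ such that $\sum_{r=1}^{2n}p_r\leq k_0+\dots+k_n$ for every path $P$. The two-variable generating function (a formal power series) is $$\mathcal{A}^{(n)}_{k_0\bar\Lambda_0+\dots+k_n\bar\Lambda_n}(z)=\mathcal{A}^{(n)}_{k_0\bar\Lambda_0+\dots+k_n\bar\Lambda_n}(z,q):=\sum_{\lambda\in\mathscr{A}_{k_0,\dots,k_n}}z^{l(\lambda)}q^{|\lambda|}.$$ Here $\bar\Lambda_0,\dots,\bar\Lambda_n$ are linearly independent symbols (scaled fundamental weights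 of $\mathrm{A}^{(2)}_{2n}$) used to index the tuple $(k_0,\dots,k_n)$; coefficients of coinciding symbols are added (e.g. when $n=1$, $\bar\Lambda_1=\bar\Lambda_n$). *)

(* Defs.v *)
From HB Require Import structures.
From mathcomp Require Import all_boot all_order all_algebra.
From mathcomp Require Import finmap multiset.
From mathcomp Require Import boolp classical_sets functions cardinality.

Set Implicit Arguments.
Unset Strict Implicit.
Unset Printing Implicit Defensive.

Import GRing.Theory.
Local Open Scope ring_scope.

(* Formal power series in one variable over R: F i is the coefficient of the
   i-th power of the variable.  The alias prevents the pointwise product of
   functions from being inferred. *)
Definition fps (R : comNzRingType) : Type := nat -> R.

Section FormalPowerSeries.
Variable R : comNzRingType.
Implicit Types (F G H : fps R) (c : R).

HB.instance Definition _ := gen_eqMixin (fps R).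
HB.instance Definition _ := gen_choiceMixin (fps R).

Definition fps_zero : fps R := fun=> 0.

Definition fps_opp F : fps R := fun i => - F i.

Definition fps_add F G : fps R := fun i => F i + G i.

Definition fps_mul F G : fps R := fun n => \sum_(i < n.+1) F i * G (n - i)%N.

Definition fpsC c : fps R := fun i => if i == 0%N then c else 0.

Definition fpsX : fps R := fun i => if i == 1%N then 1 else 0.

(* F(c x), where x is the variable *)
Definition fps_dilate c F : fps R := fun i => c ^+ i * F i.

Fact fps_addA : associative fps_add.
Proof. by move=> F G H; apply/funext => i; rewrite /fps_add addrA. Qed.

Fact fps_addC : commutative fps_add.
Proof. by move=> F G; apply/funext => i; rewrite /fps_add addrC. Qed.

Fact fps_add0 : left_id fps_zero fps_add.
Proof. by move=> F; apply/funext => i; rewrite /fps_add add0r. Qed.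

Fact fps_addN : left_inverse fps_zero fps_opp fps_add.
Proof. by move=> F; apply/funext => i; rewrite /fps_add addNr. Qed.

Let trunc n F : {poly R} := \poly_(i < n) F i.

Let fps_mul_trunc F G n i : (i < n)%N ->
  fps_mul F G i = (trunc n F * trunc n G)`_i.
Proof.
move=> lt_in; rewrite coefM; apply: eq_bigr => j _.
rewrite !coef_poly (leq_ltn_trans (leq_subr _ _) lt_in).
by rewrite (leq_ltn_trans _ lt_in) // -ltnS.
Qed.

Fact fps_mulC : commutative fps_mul.
Proof.
by move=> F G; apply/funext => n; rewrite !(fps_mul_trunc _ _ (ltnSn n)) mulrC.
Qed.

Fact fps_mulA : associative fps_mul.
Proof.
move=> F G H; apply/funext => n.
transitivity ((trunc n.+1 F * trunc n.+1 G * trunc n.+1 H)`_n).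
  rewrite -mulrA coefM; apply: eq_bigr => i _; rewrite coef_poly ltn_ord.
  by rewrite (@fps_mul_trunc _ _ n.+1) // ltnS leq_subr.
rewrite coefM; apply: eq_bigr => i _; rewrite coef_poly ltnS leq_subr.
by rewrite (@fps_mul_trunc _ _ n.+1).
Qed.

Fact fps_mul1 : left_id (fpsC 1) fps_mul.
Proof.
move=> F; apply/funext => n; rewrite /fps_mul big_ord_recl big1 ?addr0.
  by rewrite /fpsC mul1r subn0.
by move=> i _; rewrite /fpsC mul0r.
Qed.

Fact fps_mulDl : left_distributive fps_mul fps_add.
Proof.
move=> F G H; apply/funext => n.
rewrite [RHS]/fps_add /fps_mul -big_split.
by apply: eq_bigr => i _; rewrite mulrDl.
Qed.

Fact fps_one_neq0 : fpsC 1 != fps_zero.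
Proof. by apply/eqP => /(congr1 (@^~ 0%N)) /eqP; rewrite /fpsC oner_eq0. Qed.

HB.instance Definition _ := GRing.isZmodule.Build (fps R)
  fps_addA fps_addC fps_add0 fps_addN.

HB.instance Definition _ := GRing.Zmodule_isComNzRing.Build (fps R)
  fps_mulA fps_mulC fps_mul1 fps_mulDl fps_one_neq0.

End FormalPowerSeries.

(* Z[[q]][[z]], the variable z being the outer one *)
Definition zqseries : comNzRingType := fps (fps int).

Definition z : zqseries := fpsX (fps int).

Definition q : zqseries := fpsC (fpsX int).

(* F(z q^r, q) *)
Definition subst_zq (r : nat) (F : zqseries) : zqseries :=
  fps_dilate (fpsX int ^+ r) F.

Section ColouredPartitions.
Variable n : nat.

(* The part (i, c) has size i and colour c; the colours 1, ..., n are
   represented by 0, ..., n - 1 in 'I_n. *)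
Local Notation part_multiset := {mset (nat * 'I_n)}%mset.

Implicit Type lam : part_multiset.

Definition is_partition lam : Prop := forall p, p \in lam -> (0 < p.1)%N.

Definition plength lam : nat := size lam.

Definition pweight lam : nat := (\sum_(p <- lam) p.1)%N.

(* k_0 \bar\Lambda_0 + ... + k_n \bar\Lambda_n is the function j |-> k_j. *)
Definition weight := {ffun 'I_n.+1 -> nat}.

Definition Lambda (j : nat) : weight :=
  [ffun i : 'I_n.+1 => nat_of_bool (i == j :> nat)].

Implicit Type k : weight.

(* f_i^(c), extended to i = 0 and i = -1; lift ord0 c is the index in
   {0, ..., n} of the colour represented by c.  No path uses i < -1. *)
Definition frequency k lam (i : int) (c : 'I_n) : nat :=
  match i with
  | Posz 0 => if c == 0%N :> nat then k ord0 else 0%N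
  | Posz m => lam (m, c)
  | Negz 0 => k (lift ord0 c)
  | Negz _ => 0%N
  end.

(* The indices (i_1, ..., i_2n) of a path, as the values at 1, ..., 2n of a
   function; its other values are irrelevant. *)
Definition path_indices (i : nat -> int) : Prop :=
  [/\ forall c : 'I_n, 0 <= i c.*2.+1 /\ ~~ odd `|i c.*2.+1|%N,
      forall c : 'I_n, -1 <= i c.*2.+2 /\ odd `|i c.*2.+2|%N
    & forall r : nat, (1 <= r < n.*2)%N -> `|i r - i r.+1| = 1].

Definition path_sum k lam (i : nat -> int) : nat :=
  (\sum_(c < n) (frequency k lam (i c.*2.+1) c
                 + frequency k lam (i c.*2.+2) c))%N.

Definition admissible k lam : Prop :=
  is_partition lam /\
  forall i, path_indices i -> (path_sum k lam i <= \sum_(j < n.+1) k j)%N.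

Local Open Scope classical_set_scope.

(* fset_set A is empty when A is infinite; this does not occur in genfun. *)
Lemma finite_partitions (l m : nat) :
  finite_set [set lam | [/\ is_partition lam, plength lam = l
                          & pweight lam = m]].
Proof.
pose part (p : 'I_m.+1 * 'I_n) : nat * 'I_n := (val p.1, p.2).
apply: (@sub_finite_set _ _
  ((fun t : l.-tuple ('I_m.+1 * 'I_n) => seq_mset (map part t)) @` setT));
  last by apply: finite_image; exact: finite_finset.
move=> lam /= [_ size_lam weight_lam].
have le_m p : p \in enum_mset lam -> (p.1 < m.+1)%N.
  by move=> lam_p; rewrite ltnS -weight_lam /pweight (big_rem p) //= leq_addr.
pose s := [seq (inord p.1 : 'I_m.+1, p.2) | p <- lam].
have sizes : size s == l by rewrite size_map; apply/eqP.
exists (Tuple sizes) => //=; rewrite -[RHS]seq_mset_id; congr seq_mset.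
rewrite -map_comp -[RHS]map_id; apply/eq_in_map => -[i c] /le_m /= lt_im.
by rewrite /part /= inordK.
Qed.

Definition genfun k : zqseries := fun l m =>
  (#|` fset_set [set lam | [/\ admissible k lam, plength lam = l
                             & pweight lam = m]] |)%:Z.

End ColouredPartitions.

(* Main.v *)
(* Removing 1 from every part and reversing the order of the colours reverses
   the columns of the array of frequencies and moves its rows down by one: the
   frequencies of the parts of size 1 become the new row 0 and the old row 0
   becomes the new row -1.  The path conditions force the frequencies of the
   smallest parts to vanish except for one colour, and after classifying by
   those few frequencies, the path conditions before and after the shift are
   equivalent.  This gives the first identity.  For the second one, partitions
   with no part 1 and fewer than k parts 2 in colour 1 give the first term by one
   such shift; two shifts, which restore the order of the colours, handle those
   without part 1 but with k parts 2 (second term), and those with one part 1 and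
   i < k parts 2 (the sum). *)
Require Import Defs.
From mathcomp Require Import all_boot all_order all_algebra.
From mathcomp Require Import finmap multiset.
From mathcomp Require Import boolp classical_sets cardinality.
From mathcomp Require Import zify.

Set Implicit Arguments.
Unset Strict Implicit.
Unset Printing Implicit Defensive.

Import GRing.Theory.
Local Open Scope ring_scope.

(** * Paths as staircases, and the behaviour of path bounds under shifts *)

Section Staircases.
Local Open Scope nat_scope.
Variable n : nat.
Implicit Types (G H : nat -> 'I_n -> nat) (P Q : nat -> nat) (b K : nat).

(* A path with indices i_1, ..., i_2n is the staircase P r = i_(r+1) + 1. *)
Definition staircase b P : Prop :=
  [/\ forall r, r < n.*2 -> b <= P r,
      forall r, r < n.*2 -> odd (P r) = ~~ odd r
    & forall r, r.+1 < n.*2 -> P r.+1 = (P r).+1 \/ P r = (P r.+1).+1].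

Definition pair_sum G P (c : 'I_n) : nat := G (P c.*2) c + G (P c.*2.+1) c.

Definition bounded b K G : Prop :=
  forall P, staircase b P -> \sum_(c < n) pair_sum G P c <= K.

Lemma staircase_reverse b P :
  staircase b P -> staircase b.+1 (fun r => (P (n.*2 - r.+1)).+1).
Proof.
move=> [geP oddP adjP]; split=> [r ltr|r ltr|r ltr].
- by rewrite ltnS geP //; lia.
- by rewrite /= oddP; lia.
have := adjP (n.*2 - r.+2); rewrite (_ : (n.*2 - r.+2).+1 = n.*2 - r.+1); lia.
Qed.

Lemma staircase_reverse_inv b P :
  staircase b.+1 P -> staircase b (fun r => (P (n.*2 - r.+1)).-1).
Proof.
move=> [geP oddP adjP]; split=> [r ltr|r ltr|r ltr].
- by have := geP (n.*2 - r.+1); lia.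
- by have := oddP (n.*2 - r.+1); have := geP (n.*2 - r.+1); lia.
have := adjP (n.*2 - r.+2); rewrite (_ : (n.*2 - r.+2).+1 = n.*2 - r.+1); last lia.
by have := geP (n.*2 - r.+1); have := geP (n.*2 - r.+2); lia.
Qed.

(* Reversing the 2n columns restores the parities after moving up by one row. *)
Lemma bounded_shift b K G :
  bounded b K G <-> bounded b.+1 K (fun t c => G t.-1 (rev_ord c)).
Proof.
split=> bndG P stP.
  apply: leq_trans (bndG _ (staircase_reverse_inv stP)).
  rewrite (reindex_inj rev_ord_inj) leq_sum // => c _.
  rewrite /pair_sum rev_ordK /= addnC.
  have ltc := ltn_ord c.
  rewrite (_ : (n - c.+1).*2.+1 = n.*2 - c.*2.+1); last lia.
  by rewrite (_ : (n - c.+1).*2 = n.*2 - c.*2.+2) //; lia.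
apply: leq_trans (bndG _ (staircase_reverse stP)).
rewrite [leqRHS](reindex_inj rev_ord_inj) leq_sum // => c _.
rewrite /pair_sum rev_ordK /= addnC.
have ltc := ltn_ord c.
rewrite (_ : n.*2 - (n - c.+1).*2.+2 = c.*2); last lia.
by rewrite (_ : n.*2 - (n - c.+1).*2.+1 = c.*2.+1) //; lia.
Qed.

(** Transfer principle: it suffices to map paths to paths so that no colour loses weight. *)
Lemma leq_bounded b b' K G H (Q : (nat -> nat) -> nat -> nat) :
  (forall P, staircase b P -> staircase b' (Q P)) ->
  (forall P c, staircase b P -> pair_sum G P c <= pair_sum H (Q P) c) ->
  bounded b' K H -> bounded b K G.
Proof.
move=> stQ leGH bndH P stP; apply: leq_trans (bndH _ (stQ P stP)).
by apply: leq_sum => c _; apply: leGH.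
Qed.

(* Every path can be pushed off the fictitious rows: for the weights at hand
   this does not decrease its sum. *)
Definition clip1 P r := if P r == 0 then 2 else P r.

Lemma staircase_clip1 P : staircase 0 P -> staircase 1 (clip1 P).
Proof.
move=> [_ oddP adjP]; split=> r ltr; rewrite /clip1.
- by case: ifP; lia.
- by have := oddP r ltr; case: ifP; lia.
have := adjP r ltr; have := oddP r; have := oddP r.+1.
by do ?case: ifP; lia.
Qed.

Definition clip2 P r :=
  if P r == 0 then 2 else if P r == 1 then 3 else P r.

Lemma staircase_clip2 P : staircase 0 P -> staircase 2 (clip2 P).
Proof.
move=> [_ oddP adjP]; split=> r ltr; rewrite /clip2.
- by do ?case: ifP; lia.
- by have := oddP r ltr; do ?case: ifP; lia.
have := adjP r ltr; have := oddP r; have := oddP r.+1.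
by do ?case: ifP; lia.
Qed.

Lemma staircase_pair b P (c : 'I_n) : staircase b P ->
  [/\ b <= P c.*2, b <= P c.*2.+1, odd (P c.*2), ~~ odd (P c.*2.+1)
    & P c.*2.+1 = (P c.*2).+1 \/ P c.*2 = (P c.*2.+1).+1].
Proof.
move=> [geP oddP adjP]; have ltc := ltn_ord c.
by split; [apply: geP| apply: geP| rewrite oddP| rewrite oddP | apply: adjP]; lia.
Qed.


(* G is the array of the partition and H, from row 1 on, the one of the shifted
   partition, in the coordinates of G. *)
Lemma bounded_last K a d i G H : i <= a ->
    (forall c, G 0 c = a * (c.+1 == n)) -> (forall c, G 1 c = d * (c == 0 :> nat)) ->
    (forall c, G 2 c = i * (c.+1 == n)) ->
    (forall c, H 1 c = (a - i) * (c.+1 == n) + d * (c == 0 :> nat)) ->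
    (forall t c, 1 < t -> H t c = G t c) ->
  bounded 0 K G <-> bounded 1 K H.
Proof.
move=> leia G0 G1 G2 H1 HG; split.
  (* A path of H through rows 1 and 2 of the last colour collects (a - i) + i = a there, plus d if n
     = 1. G finds the same a in row 0, so the last step is redirected to that row. *)
  pose Q P r := if (r == n.*2.-1) && (P n.*2.-2 == 1) then 0 else P r.
  apply: (@leq_bounded _ _ _ _ _ Q) => [P|P c] stP.
    have [geP oddP adjP] := stP; split=> r ltr //; rewrite /Q.
      by have := oddP r ltr; case: ifP; lia.
    have := adjP r ltr; have := oddP r.+1 ltr.
    case: (eqVneq r.+1 n.*2.-1) => [eqr|ner]; last by rewrite ifN //; lia.
    by rewrite [n.*2.-2](_ : _ = r); [do ?case: ifP; lia|lia].
  have [] := staircase_pair c stP; have ltc := ltn_ord c.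
  rewrite /pair_sum /Q (_ : (c.*2 == n.*2.-1) = false) /=; last lia.
  rewrite (_ : (c.*2.+1 == n.*2.-1) = (c.+1 == n)); last lia.
  case: (eqVneq c.+1 n) => [eqc|nec] /=; last first.
    by case: (P c.*2) (P c.*2.+1) => [|[|x]] [|[|y]] // *;
      rewrite ?H1 ?HG // ?G1 (negbTE nec); lia.
  rewrite (_ : n.*2.-2 = c.*2); last lia.
  case: (P c.*2) (P c.*2.+1) => [|[|x]] [|[|[|y]]] //= *;
      rewrite ?H1 ?HG // ?G1 ?G2 ?G0 ?eqc ?eqxx; lia.
apply: (@leq_bounded _ _ _ _ _ clip1 staircase_clip1) => P c stP.
have [] := staircase_pair c stP; rewrite /pair_sum /clip1.
by case: (P c.*2) (P c.*2.+1) => [|[|x]] [|[|[|y]]] //= *;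
   rewrite ?H1 ?HG // ?G1 ?G2 ?G0; lia.
Qed.

(** Counterpart for two shifts, with H given from row 2 on. In the first colour both arrays reach h
    + 1 in their lowest rows: G in rows 1 and 0, H in rows 3 and 2, where i + (h + 1 - i) = h +
    1. *)
Lemma bounded_first K h i j G H : j = (i <= h) -> i <= h.+1 ->
    (forall c, G 0 c = (c == 0 :> nat)) -> (forall c, G 1 c = h * (c == 0 :> nat)) ->
    (forall c, G 2 c = j * (c == 0 :> nat)) ->
    (forall c, G 3 c = i * (c == 0 :> nat)) ->
    (forall c, H 2 c = (h.+1 - i) * (c == 0 :> nat)) ->
    (forall t c, 2 < t -> H t c = G t c) ->
  bounded 0 K G <-> bounded 2 K H.
Proof.
move=> ej leih G0 G1 G2 G3 H2 HG; split.
  (* To match the h + 1 of rows 3 and 2 of H: if i <= h, then j = 1 and rows 1 and 2 of G give h +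
     1; if i = h + 1, rows 3 and 2 of G already do. *)
  pose Q P r := if [&& r == 0, P 1 == 2 & i <= h] then 1 else P r.
  apply: (@leq_bounded _ _ _ _ _ Q) => [P|P c] stP.
    have [geP oddP adjP] := stP; split=> r ltr //; rewrite /Q.
      by have := oddP r ltr; case: ifP; lia.
    have := adjP r ltr; have := oddP r.+1 ltr.
    by case: r ltr => [|r] ltr /=; do ?case: ifP; lia.
  have [] := staircase_pair c stP; have ltc := ltn_ord c.
  rewrite /pair_sum /Q double_eq0 /=.
  case: (eqVneq (c : nat) 0) => [->|nec] /=; last first.
    by case: (P c.*2) (P c.*2.+1) => [|[|[|x]]] [|[|[|y]]] // *;
      rewrite ?H2 ?HG // (negbTE nec); lia.
  case: (P 0) (P 1) => [|[|[|[|x]]]] [|[|[|[|y]]]] //= *;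
    rewrite ?H2 ?HG //; case: ifP => lt; rewrite ?H2 ?G1 ?G2 ?G3; lia.
apply: (@leq_bounded _ _ _ _ _ clip2 staircase_clip2) => P c stP.
have [] := staircase_pair c stP; rewrite /pair_sum /clip2.
by case: (P c.*2) (P c.*2.+1) => [|[|[|[|x]]]] [|[|[|[|y]]]] //= *;
   rewrite ?H2 ?HG // ?G1 ?G2 ?G0 ?G3; nia.
Qed.

End Staircases.

(** * Path bounds for the class without parts of size 1 *)

Section StaircaseBounds.
Local Open Scope nat_scope.

(** One unit changes colour: it lies in row 0 of the first colour in G, but in row 1 of the second
    colour in H (in row 2 if n = 1). Hence the first two colours are compared jointly, not colour by
    colour. *)
Lemma bounded_middle n h (G H : nat -> 'I_n -> nat) :
    (forall c, G 0 c = (c == 0 :> nat)) -> (forall c, G 1 c = h * (c == 0 :> nat)) ->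
    (forall c, G 2 c = 0) ->
    (forall c, H 1 c = (c == 1 :> nat) + h * (c == 0 :> nat)) ->
    (forall c, H 2 c = (n == 1)) -> (forall t c, 2 < t -> H t c = G t c) ->
  bounded 0 h.+1 G /\ (forall c : 'I_n, c = 0 :> nat -> G 3 c <= h)
  <-> bounded 1 h.+1 H.
Proof.
move=> G0 G1 G2 H1 H2 HG; split=> [[bndG G3] P stP | bndH]; last split.
- have [geP oddP adjP] := stP.
  case: (ltngtP n 1) => [n0|n_gt1|n1].
  + by rewrite big1 // => -[c ltc]; lia.
  (* If P enters the second colour in row 1, it leaves the first in row 2, where H vanishes.
     Starting in rows 1 and 0 instead, G collects h + 1, which covers the unit of H and the at most
     h of its first column; [G3] is needed when P starts in row 3. *)
  + pose Q r := if (P 2 == 1) && (r == 0) then 1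
                else if (P 2 == 1) && (r == 1) then 0 else P r.
    have stQ : staircase n 0 Q.
      split=> r ltr //.
        by have := oddP r ltr; rewrite /Q; do ?case: ifP; lia.
      have := adjP _ ltr.
      by case: r ltr => [|[|r]] ltr; rewrite /Q; do ?case: ifP; lia.
    have := bndG Q stQ.
    pose c0 : 'I_n := Ordinal (ltnW n_gt1); pose c1 : 'I_n := Ordinal n_gt1.
    rewrite (bigD1 c0) //= (bigD1 c1) //= (bigD1 c0 (P := xpredT)) //=.
    rewrite [in X in _ -> X](bigD1 c1) //=.
    set s := \sum_(i < n | _) _; set s' := \sum_(i < n | _) _.
    have -> : s' = s.
      apply: eq_bigr => i ne; have := staircase_pair i stP.
      have : (1 < i) by move: ne; rewrite -!val_eqE /=; lia.
      rewrite /pair_sum /Q; case: i {ne} => [[|[|i]] lti] //= _; rewrite !andbF.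
      by case: (P _) (P _) => [|[|[|x]]] [|[|[|y]]] [] //= *;
        rewrite ?H1 ?H2 ?G1 ?G2 ?HG //=; lia.
    have := staircase_pair c0 stP; have := staircase_pair c1 stP.
    have := adjP 1; have := G3 c0 erefl.
    rewrite /pair_sum /Q /= !andbT.
    by case: (P 0) (P 1) (P 2) (P 3)
      => [|[|[|[|p0]]]] [|[|[|p1]]] [|[|[|p2]]] [|[|[|p3]]] /= ? ?
        [? ? ? ? ?] [? ? ? ? ?];
      rewrite ?H1 ?H2 ?G0 ?G1 ?G2 ?HG //=; lia.
  + subst n; have := staircase_pair ord0 stP; have := G3 ord0 erefl.
    have := bndG P; rewrite !big_ord1 /pair_sum /= => leG.
    have {}leG : staircase 1 0 P -> G (P 0) ord0 + G (P 1) ord0 <= h.+1 by [].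
    have {}leG := leG (And3 (fun _ _ => isT) oddP adjP); move: leG.
    case: (P 0) (P 1) => [|[|[|[|p0]]]] [|[|[|p1]]] //= ? ? [? ? ? ? ?];
      rewrite ?H1 ?H2 ?G0 ?G1 ?G2 ?HG //=; lia.
- move=> P stP; have [geP oddP adjP] := stP.
  have := bndH _ (staircase_clip1 stP).
  case: (ltngtP n 1) => [n0|n_gt1|n1].
  + by rewrite !big1 // => -[c ltc]; lia.
  + pose c0 : 'I_n := Ordinal (ltnW n_gt1); pose c1 : 'I_n := Ordinal n_gt1.
    rewrite (bigD1 c0) //= (bigD1 c1) //= (bigD1 c0 (P := xpredT)) //=.
    rewrite [in X in _ -> X](bigD1 c1) //=.
    set s := \sum_(i < n | _) _; set s' := \sum_(i < n | _) _.
    have : s' <= s.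
      apply: leq_sum => i ne; have := staircase_pair i stP.
      have : (1 < i) by move: ne; rewrite -!val_eqE /=; lia.
      rewrite /pair_sum /clip1; case: i {ne} => [[|[|i]] lti] //= _.
      by case: (P _) (P _) => [|[|[|x]]] [|[|[|y]]] [] //= *;
        rewrite ?H1 ?H2 ?G1 ?G2 ?G0 ?HG //=; lia.
    have := staircase_pair c0 stP; have := staircase_pair c1 stP.
    have := adjP 1; rewrite /pair_sum /clip1 /=.
    case: (P 0) (P 1) (P 2) (P 3)
      => [|[|[|p0]]] [|[|[|p1]]] [|[|[|p2]]] [|[|[|p3]]] /= ?
        [? ? ? ? ?] [? ? ? ? ?];
      rewrite ?H1 ?H2 ?G0 ?G1 ?G2 ?HG //=; lia.
  + subst n; have := staircase_pair ord0 stP.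
    rewrite !big_ord1 /pair_sum /clip1 /=.
    case: (P 0) (P 1) => [|[|[|p0]]] [|[|[|p1]]] //= [? ? ? ? ?];
      rewrite ?H1 ?H2 ?G0 ?G1 ?G2 ?HG //=; lia.
(* The path 3, 2, 1, 2, 1, 2, ... collects [G 3 c] and the extra unit, wherever n places it. *)
move=> c c0; pose P r := if r == 0 then 3 else if odd r then 2 else 1.
have stP : staircase n 1 P.
  by split=> r ltr; rewrite /P; case: r ltr => [|r] ltr /=; do ?case: ifP; lia.
have := bndH P stP; rewrite (bigD1 c) //= /pair_sum /P c0 /= HG // H2.
have [n1|n_neq1] := eqVneq n 1; first by lia.
have n_gt1 : 1 < n by have := ltn_ord c; lia.
rewrite (bigD1 (Ordinal n_gt1)) //= ?H1 /=; first lia.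
by rewrite -val_eqE /= c0.
Qed.

End StaircaseBounds.

(** * Frequencies of the smallest parts forced by the path bounds *)

Section Forced.
Local Open Scope nat_scope.
Variable n : nat.
Implicit Types (G : nat -> 'I_n -> nat) (c : 'I_n).

Lemma sum_eq_at j d : j < n -> \sum_(c < n) d * (c == j :> nat) = d.
Proof.
move=> ltj; rewrite (bigD1 (Ordinal ltj)) //= eqxx muln1 big1 ?addn0 // => c.
by rewrite -val_eqE /= => /negbTE ->; rewrite muln0.
Qed.

(** The path 1, 2, 1, 2, ... collects d and [G 2 c]. If c is not the last colour, ending in row 0
    adds a and leaves no room for [G 2 c]. *)
Lemma bounded_last_row1 a d G :
    (forall c, G 0 c = a * (c.+1 == n)) -> (forall c, G 1 c = d * (c == 0 :> nat)) ->
  bounded 0 (d + a) G -> forall c, G 2 c <= a * (c.+1 == n).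
Proof.
move=> G0 G1 bndG c; have ltc := ltn_ord c.
pose P r := if odd r then if (r == n.*2.-1) && (c.+1 < n) then 0 else 2 else 1.
have stP : staircase n 0 P by split=> r ltr; rewrite /P /=; do ?case: ifP; lia.
have := bndG P stP.
(* The weights met are written as indicators of colours, so that the comparison is termwise even
   when these colours coincide. *)
have : \sum_(c' < n) (d * (c' == 0 :> nat) + (c.+1 < n) * a * (c' == n.-1 :> nat)
                      + G 2 c * (c' == c :> nat)) <= \sum_(c' < n) pair_sum G P c'.
  apply: leq_sum => c' _; rewrite /pair_sum /P /= !odd_double /=.
  have := ltn_ord c'.
  by case: (eqVneq (c' : nat) c) => [/val_inj ->|_] *; case: ifP => *;
    rewrite ?G0 ?G1; nia.
by rewrite !big_split /= !sum_eq_at //; nia.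
Qed.

(** The same path; if c is not the first colour, the detour to row 0 in the second column adds 1. *)
Lemma bounded_first_row1 h G :
    (forall c, G 0 c = (c == 0 :> nat)) -> (forall c, G 1 c = h * (c == 0 :> nat)) ->
  bounded 0 h.+1 G -> forall c, G 2 c <= (c == 0 :> nat).
Proof.
move=> G0 G1 bndG c; have ltc := ltn_ord c; have lt0 : 0 < n by lia.
pose P r := if odd r then if (r == 1) && (0 < c) then 0 else 2 else 1.
have stP : staircase n 0 P by split=> r ltr; rewrite /P /=; do ?case: ifP; lia.
have := bndG P stP.
have : \sum_(c' < n) (h * (c' == 0 :> nat) + (0 < c) * (c' == 0 :> nat)
                      + G 2 c * (c' == c :> nat))
       <= \sum_(c' < n) pair_sum G P c'.
  apply: leq_sum => c' _; rewrite /pair_sum /P /= !odd_double /=.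
  by case: (eqVneq (c' : nat) c) => [/val_inj ->|_] *; case: ifP => *;
    rewrite ?G0 ?G1; nia.
by rewrite !big_split /= !sum_eq_at //; lia.
Qed.

(** Read off from the paths 1, 2, 3, 2, 3, 2, ... and 3, 2, 3, 2, .... *)
Lemma bounded_first_row2 h j G :
    (forall c, G 1 c = h * (c == 0 :> nat)) ->
    (forall c, G 2 c = j * (c == 0 :> nat)) ->
  bounded 0 h.+1 G ->
  forall c c0, c0 = 0 :> nat ->
  [/\ G 3 c0 + j <= h.+1,
      0 < c -> h + j + G 3 c <= h.+1
    & 0 < c -> G 3 c0 + G 3 c <= h.+1].
Proof.
move=> G1 G2 bndG c c0 c00; have ltc := ltn_ord c; have lt0 : 0 < n by lia.
pose P x r := if odd r then 2 else if r == 0 then x else 3.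
have stP x : (x == 1) || (x == 3) -> staircase n 0 (P x).
  by move=> x13; split=> r ltr; rewrite /P /=; do ?case: ifP; lia.
have := bndG _ (stP 1 isT); have := bndG _ (stP 3 isT).
have : \sum_(c' < n) (h * (c' == 0 :> nat) + j * (c' == 0 :> nat)
                      + (0 < c) * G 3 c * (c' == c :> nat))
       <= \sum_(c' < n) pair_sum G (P 1) c'.
  apply: leq_sum => c' _; rewrite /pair_sum /P /= !odd_double /= double_eq0.
  by case: (eqVneq (c' : nat) c) => [/val_inj ->|_] *; case: ifP => *;
    rewrite ?G2 ?G1; nia.
have : \sum_(c' < n) (G 3 c0 * (c' == 0 :> nat) + j * (c' == 0 :> nat)
                      + (0 < c) * G 3 c * (c' == c :> nat))
       <= \sum_(c' < n) pair_sum G (P 3) c'.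
  apply: leq_sum => c' _; rewrite /pair_sum /P /= !odd_double /= if_same G2.
  case: (eqVneq (c' : nat) 0) => [e|_].
    have -> : c' = c0 by apply: val_inj; rewrite /= e c00.
    by rewrite c00; nia.
  by case: (eqVneq (c' : nat) c) => [/val_inj ->|_]; case: (0 < c);
    rewrite ?muln0 ?muln1; lia.
rewrite !big_split /= !sum_eq_at //.
by move=> *; split; case: (posnP c) => *; nia.
Qed.
End Forced.

(** * Raising all parts and adjoining small ones *)

Section Raise.
Local Open Scope nat_scope.
Variables (n : nat) (f : 'I_n -> 'I_n) (r : nat) (s : seq (nat * 'I_n)).
Hypothesis fK : involutive f.
Implicit Type lam mu : {mset (nat * 'I_n)}%mset.

(** Inverse of the removal step: [s] restores the small parts that the removal loses. *)
Definition raise mu : {mset (nat * 'I_n)}%mset :=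
  seq_mset ([seq (p.1 + r, f p.2) | p <- mu] ++ s).

Lemma raiseE mu x c :
  raise mu (x, c) = (if r <= x then mu (x - r, f c) else 0) + count_mem (x, c) s.
Proof.
rewrite /raise mset_seqE count_cat; congr (_ + _); rewrite count_map.
case: leqP => [lerx|ltxr].
  rewrite -count_mem_mset; apply: eq_count => -[y d] /=.
  by rewrite !xpair_eqE (can2_eq fK fK) -(eqn_add2r r y) subnK.
rewrite -(count_pred0 mu); apply: eq_count => -[y d] /=.
by rewrite xpair_eqE /=; case: eqP => //=; lia.
Qed.

Lemma raise_inj : injective raise.
Proof.
move=> mu nu eqmn; apply/msetP => -[x c].
have := congr1 (fun lam : {mset _}%mset => lam (x + r, f c)) eqmn.
by rewrite /= !raiseE leq_addl addnK fK => /addIn.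
Qed.

Lemma plength_raise mu : plength (raise mu) = plength mu + size s.
Proof.
by rewrite /plength (perm_size (perm_eq_seq_mset _)) size_cat size_map.
Qed.

Lemma pweight_raise mu :
  pweight (raise mu) = pweight mu + r * plength mu + \sum_(p <- s) p.1.
Proof.
rewrite /pweight /plength (perm_big _ (perm_eq_seq_mset _)) /= big_cat big_map /=.
by rewrite big_split /= big_const_seq count_predT iter_addn addn0.
Qed.

Lemma is_partition_raise mu : (forall p, p \in s -> 0 < p.1) ->
  is_partition mu -> is_partition (raise mu).
Proof.
move=> s_gt0 mu_gt0 p; rewrite -mset_neq0 mset_seqE -lt0n -has_count has_pred1.
rewrite mem_cat => /orP[/mapP[p' /mu_gt0 p'_gt0 ->]|/s_gt0//] /=.
by rewrite addn_gt0 p'_gt0.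
Qed.

(** The preimage drops the parts of size at most r, which are exactly [s], and lowers the others by
    r; [f], being an involution, undoes its own recolouring. *)
Lemma raise_onto lam :
    (forall x c, x <= r -> lam (x, c) = count_mem (x, c) s) ->
    (forall p, p \in s -> p.1 <= r) ->
  exists2 mu, is_partition mu & lam = raise mu.
Proof.
move=> lam_low s_low.
exists (seq_mset [seq (p.1 - r, f p.2) | p <- lam & r < p.1]).
  move=> p; rewrite -mset_neq0 mset_seqE -lt0n -has_count has_pred1.
  by case/mapP => p'; rewrite mem_filter => /andP[ltr _] -> /=; rewrite subn_gt0.
apply/msetP => -[x c]; rewrite raiseE mset_seqE count_map count_filter.
have [lexr|ltrx] := leqP x r.
  rewrite lam_low // [X in _ = (if _ then X else _) + _](@eq_count _ _ pred0).
    by rewrite count_pred0 if_same.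
  move=> -[y d] /=.
  by rewrite xpair_eqE /=; case: (f d == f c); rewrite ?andbF //; lia.
rewrite ltnW // (count_memPn _) ?addn0; last first.
  by apply: contraTN ltrx => /s_low /=; rewrite -leqNgt.
rewrite -count_mem_mset; apply: eq_count => -[y d] /=.
rewrite !xpair_eqE (inj_eq (can_inj fK)).
by case: (d == c); rewrite ?andbF //; lia.
Qed.

End Raise.

(** * Admissibility in terms of staircases *)

Section Grid.
Local Open Scope nat_scope.
Variable n : nat.
Implicit Types (k : weight n) (lam : {mset (nat * 'I_n)}%mset).

(** Row t carries the frequencies of index t - 1, so the fictitious indices -1 and 0 become rows 0
    and 1. *)
Definition grid k lam (t : nat) (c : 'I_n) : nat :=
  match t with
  | 0 => k (lift ord0 c)
  | 1 => k ord0 * (c == 0 :> nat)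
  | t.+2 => lam (t.+1, c)
  end.

Lemma frequency_grid k lam t c : frequency k lam (t%:Z - 1)%R c = grid k lam t c.
Proof.
case: t => [|[|t]].
- by [].
- by rewrite subrr /=; case: eqP => _; rewrite ?muln1 ?muln0.
by rewrite (_ : t.+2%:Z - 1 = t.+1%:Z)%R //; lia.
Qed.

Lemma admissibleE k lam :
  admissible k lam
  <-> is_partition lam /\ bounded 0 (\sum_(j < n.+1) k j) (grid k lam).
Proof.
split=> -[part_lam bnd]; split=> // P stP.
  have [_ oddP adjP] := stP.
  apply: leq_trans (bnd (fun r => ((P r.-1)%:Z - 1)%R) _).
    by apply: leq_sum => c _; rewrite /= !frequency_grid.
  split=> [c|c|[|r] ltr //]; first 2 last.
  - by have := adjP r ltr; rewrite [r.+2.-1]/= [r.+1.-1]/=; lia.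
  - have [_ _ ? _ _] := staircase_pair c stP; cbv beta; rewrite -pred_Sn; lia.
  by have [_ _ _ ? _] := staircase_pair c stP; cbv beta; rewrite -pred_Sn; lia.
have [evenP oddP adjP] := stP.
(* Column r belongs to colour [r./2], and the parity of r selects the path condition that
   applies. *)
have lowP r : r < n.*2 ->
    (0 <= P r.+1 + 1)%R /\ odd (absz (P r.+1 + 1)%R) = ~~ odd r.
  move=> ltr; have ltc : r./2 < n by lia.
  have := evenP (Ordinal ltc); have := oddP (Ordinal ltc); rewrite /=.
  have [oddr|evenr] := boolP (odd r).
    rewrite (_ : r./2.*2.+2 = r.+1); last lia.
    by case: (P r.+1) => [m|m] [? ?]; lia.
  rewrite (_ : r./2.*2.+1 = r.+1); last lia.
  by case: (P r.+1) => [m|m] [? ?]; lia.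
have absP r : r < n.*2 -> (P r.+1 = (absz (P r.+1 + 1)%R)%:Z - 1)%R.
  by move=> /lowP[ge0 _]; lia.
have stQ : staircase n 0 (fun r => absz (P r.+1 + 1)%R).
  split=> // r ltr; first by have [] := lowP r ltr.
  have := adjP r.+1; have := absP r; have := absP r.+1; lia.
apply: leq_trans (bnd _ stQ); apply: leq_sum => c _; have ltc := ltn_ord c.
by rewrite /pair_sum -!frequency_grid -!absP //; lia.
Qed.

End Grid.

(** * Admissibility before and after raising *)

Section AdmissibleRaise.
Variable n : nat.
Hypothesis n_gt0 : (0 < n)%N.
Implicit Types (mu lam : {mset (nat * 'I_n)}%mset) (k : weight n) (c : 'I_n).

Let c0 : 'I_n := Ordinal n_gt0.

Lemma LambdaMnE a d (j : 'I_n.+1) : (Lambda n a *+ d) j = (d * (j == a :> nat))%N.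
Proof. by rewrite ffunMnE ffunE -mulr_natl natn. Qed.

Lemma LambdaE a (j : 'I_n.+1) : Lambda n a j = (j == a :> nat).
Proof. by rewrite ffunE. Qed.

Lemma weightDE k k' (j : 'I_n.+1) : (k + k') j = (k j + k' j)%N.
Proof. by rewrite ffunE. Qed.

Lemma sum_LambdaMn a d :
  (a <= n)%N -> (\sum_(j < n.+1) (Lambda n a *+ d)%R j)%N = d.
Proof.
by move=> lean; under eq_bigr => j _ do rewrite LambdaMnE; apply: sum_eq_at.
Qed.

Lemma sum_weightD k k' :
  (\sum_(j < n.+1) (k + k')%R j = \sum_(j < n.+1) k j + \sum_(j < n.+1) k' j)%N.
Proof. by under eq_bigr => j _ do rewrite weightDE; rewrite big_split. Qed.

Lemma partition_size0 mu c : is_partition mu -> mu (0%N, c) = 0%N.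
Proof. by move=> part_mu; apply/mset_eq0P/negP => /part_mu. Qed.

Local Open Scope nat_scope.

Definition weightE := (weightDE, LambdaMnE, LambdaE).

(** After the shift, the coefficients a - i and k - a occupy row 1 in the last and the first colour,
    and the coefficient i of [Lambda n 0] lands in row 2, on the i adjoined parts 1. *)
Lemma admissible_raise_last a i (k : nat) mu : i <= a -> a <= k -> is_partition mu ->
  admissible (Lambda n 0 *+ (k - a) + Lambda n n *+ a)%R
    (raise (@rev_ord n) 1 (nseq i (1, rev_ord c0)) mu)
  <-> admissible
        (Lambda n 0 *+ i + Lambda n 1 *+ (a - i) + Lambda n n *+ (k - a))%R mu.
Proof.
move=> leia leak part_mu; rewrite !admissibleE.
rewrite !sum_weightD !sum_LambdaMn //.
rewrite (_ : i + (a - i) + (k - a) = k - a + a); last lia.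
set G := grid _ _; set H := grid _ mu.
have {}bndE : bounded 0 (k - a + a) G <-> bounded 0 (k - a + a) H.
  rewrite (bounded_shift _ _ H); apply: (@bounded_last _ _ a (k - a) i) => //.
  - by move=> c; rewrite /G /= !weightE /= /bump /= add1n; lia.
  - by move=> c; rewrite /G /= !weightE /=; lia.
  - move=> c; rewrite /G /= raiseE; last exact: rev_ordK.
    rewrite partition_size0 // count_nseq /= xpair_eqE -val_eqE /=.
    by have := ltn_ord c; lia.
  - move=> c; rewrite /H /= !weightE /= /bump /= !add1n; have := ltn_ord c; lia.
  move=> [|[|[|t]]] c //= _.
    rewrite /H /G /= !weightE raiseE; last exact: rev_ordK.
    rewrite partition_size0 // count_nseq /= xpair_eqE -val_eqE /=.
    by have := ltn_ord c; lia.
  rewrite /H /G /= raiseE; last exact: rev_ordK.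
  by rewrite count_nseq addn0 subn1.
rewrite bndE; split=> -[_ bnd]; split=> //.
by apply: is_partition_raise => // p /nseqP[->].
Qed.

(** The side condition counts the parts 2 of the first colour in the raised partition. *)
Lemma admissible_raise_middle h mu : is_partition mu ->
  admissible (Lambda n 0 *+ h + Lambda n 1)%R (raise (@rev_ord n) 1 [::] mu)
    /\ mu (1, rev_ord c0) <= h
  <-> admissible (Lambda n (n - 1) + Lambda n n *+ h)%R mu.
Proof.
move=> part_mu; rewrite !admissibleE.
rewrite -[Lambda n 1]mulr1n -[Lambda n (n - 1)]mulr1n.
rewrite !sum_weightD !sum_LambdaMn ?leq_subr // add1n addn1.
set G := grid _ _; set H := grid _ mu.
have raise1 x c : raise (@rev_ord n) 1 [::] mu (x.+1, c) = mu (x, rev_ord c).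
  by rewrite raiseE ?addn0 ?subn1 //; exact: rev_ordK.
have := @bounded_middle n h G (fun t c => H t.-1 (rev_ord c)).
have -> : (forall c, c = 0 :> nat -> G 3 c <= h) <-> mu (1, rev_ord c0) <= h.
  rewrite /G /=; split=> [/(_ c0 erefl)|? c e]; rewrite raise1 //.
  by rewrite (_ : c = c0) //; apply: val_inj.
rewrite -(bounded_shift _ _ H) => bndE.
rewrite -{}bndE.
- split=> [[[_ bnd] mu1]|[_ [bnd mu1]]]; do !split=> //.
  by apply: is_partition_raise.
- by move=> c; rewrite /G /= !weightE /= /bump /= add1n; lia.
- by move=> c; rewrite /G /= !weightE /=; lia.
- by move=> c; rewrite /G /= raise1 partition_size0.
- by move=> c; rewrite /H /= !weightE /= /bump /= !add1n; have := ltn_ord c; lia.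
- by move=> c; rewrite /H /= !weightE /=; have := ltn_ord c; lia.
by move=> [|[|[|t]]] c //= _; rewrite /G /= raise1.
Qed.

(** Two reversals cancel, so colours are kept. The truth value of [i <= h] is the number of parts 1,
    which treats the last two terms of the second identity at once. *)
Lemma admissible_raise_first h i mu : i <= h.+1 -> is_partition mu ->
  admissible (Lambda n 0 *+ h + Lambda n 1)%R
    (raise id 2 (nseq (i <= h) (1, c0) ++ nseq i (2, c0)) mu)
  <-> admissible (Lambda n 0 *+ i + Lambda n 1 *+ (h.+1 - i))%R mu.
Proof.
move=> leih part_mu; rewrite !admissibleE.
rewrite -{1}[Lambda n 1]mulr1n.
rewrite !sum_weightD !sum_LambdaMn // addn1 subnKC //.
set G := grid _ _; set H := grid _ mu.
have raise2 x c : raise id 2 (nseq (i <= h) (1, c0) ++ nseq i (2, c0)) mu (x.+1, c)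
    = (if x is x'.+1 then mu (x', c) else 0)
      + ((i <= h) * (x == 0) + i * (x == 1)) * (c == 0 :> nat).
  rewrite raiseE // count_cat !count_nseq /= !xpair_eqE -!val_eqE /=.
  by case: x => [|[|x]] //=; rewrite ?subn2 /=; lia.
have bndE : bounded 0 h.+1 G <-> bounded 0 h.+1 H.
  rewrite (bounded_shift 0 _ H) (bounded_shift 1).
  apply: (@bounded_first _ _ h i (i <= h)) => //.
  - by move=> c; rewrite /G /= !weightE /= /bump /= add1n; lia.
  - by move=> c; rewrite /G /= !weightE /=; lia.
  - by move=> c; rewrite /G /= raise2 /=; lia.
  - by move=> c; rewrite /G /= raise2 /= partition_size0 //; lia.
  - by move=> c; rewrite /H /= rev_ordK !weightE /= /bump /= !add1n; lia.
  move=> [|[|[|[|t]]]] c // _; rewrite rev_ordK /G /H /= raise2 /=.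
    by rewrite partition_size0 // !weightE /=; lia.
  lia.
rewrite bndE; split=> -[_ bnd]; split=> //.
by apply: is_partition_raise => // p; rewrite mem_cat => /orP[] /nseqP[->].
Qed.

End AdmissibleRaise.

(** * Coefficients of products with constants and powers of the variable *)

Section PowerSeries.
Variable R : comNzRingType.
Implicit Types (F G : fps R) (c : R).

Lemma fps_sumE (I : Type) (s : seq I) (P : pred I) (F : I -> fps R) i :
  (\sum_(j <- s | P j) F j) i = \sum_(j <- s | P j) F j i.
Proof. exact: (big_morph (fun F : fps R => F i)). Qed.

Lemma fpsCM c F i : (fpsC c * F) i = c * F i.
Proof.
rewrite [LHS]big_ord_recl big1 ?addr0 /fpsC /= ?subn0 // => j _.
by rewrite mul0r.
Qed.

Lemma fpsC_exp c d : fpsC c ^+ d = fpsC (c ^+ d).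
Proof.
elim: d => [|d IHd] //; rewrite !exprS IHd; apply/funext => i.
by rewrite fpsCM /fpsC; case: eqP; rewrite ?mulr0.
Qed.

Lemma fpsXM F i : (fpsX R * F) i = if i is i'.+1 then F i' else 0.
Proof.
case: i => [|i]; first by rewrite [LHS]big_ord1 mul0r.
rewrite [LHS]big_ord_recl mul0r add0r big_ord_recl mul1r subn1 big1 ?addr0 //.
by move=> j _; rewrite mul0r.
Qed.

Lemma fpsXnM d F i : (fpsX R ^+ d * F) i = if (d <= i)%N then F (i - d)%N else 0.
Proof.
elim: d i => [|d IHd] i; first by rewrite expr0 mul1r subn0.
by rewrite exprS -mulrA fpsXM; case: i => // i; rewrite IHd subSS.
Qed.

End PowerSeries.

(** * Generating functions of classes of coloured partitions *)

Section GeneratingFunctions.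
Variable n : nat.
Local Notation part_multiset := {mset (nat * 'I_n)}%mset.
Implicit Types A B : part_multiset -> Prop.
Local Open Scope classical_set_scope.

Let level A (l m : nat) :=
  [set lam : part_multiset | [/\ A lam, plength lam = l & pweight lam = m]].

Definition gf A : zqseries := fun l m => (#|` fset_set (level A l m)|)%:Z.

Lemma finite_level A l m :
  (forall lam, A lam -> is_partition lam) -> finite_set (level A l m).
Proof.
move=> partA; apply: sub_finite_set (finite_partitions n l m).
by move=> lam [/partA].
Qed.

Lemma eq_gf A B : (forall lam, A lam <-> B lam) -> gf A = gf B.
Proof. by move=> eqAB; congr gf; apply/funext => lam; apply/propext. Qed.

Lemma gf_partition (T : finType) (tau : part_multiset -> T) A :
    (forall lam, A lam -> is_partition lam) ->
  gf A = \sum_(t : T) gf (fun lam => A lam /\ tau lam = t).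
Proof.
move=> partA; apply/funext => l; apply/funext => m.
rewrite !fps_sumE /gf -(big_morph _ PoszD (erefl 0%:Z)); congr (_%:Z).
rewrite card_fset_sum1 (partition_big tau xpredT) //=; apply: eq_bigr => t _.
rewrite card_fset_sum1 -big_filter; apply: perm_big; apply: uniq_perm.
- by rewrite filter_uniq // fset_uniq.
- exact: fset_uniq.
move=> lam; rewrite mem_filter !in_fset_set;
  try by apply: finite_level => // ? [/partA].
apply/andP/idP; rewrite !inE /=; first by case=> /eqP ? [].
by case=> -[? ->] ? ?.
Qed.

(** Raising turns z^l q^m into z^l q^(m + r l), which is the substitution of z q^r for z; the parts
    of [s] give the monomial in front. *)
Lemma gf_raise (f : 'I_n -> 'I_n) r s A : involutive f ->
    (forall mu, A mu -> is_partition mu) ->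
  gf (fun lam => exists2 mu, A mu & lam = raise f r s mu)
  = z ^+ size s * q ^+ (\sum_(p <- s) p.1)%N * subst_zq r (gf A).
Proof.
move=> fK partA; apply/funext => l; apply/funext => m.
rewrite -mulrA fpsXnM; case: (leqP (size s) l) => [le_sl|lt_ls]; last first.
  rewrite /gf (_ : level _ l m = set0) ?fset_set0 //.
  by apply/seteqP; split=> // lam [[mu _ ->]]; rewrite plength_raise; lia.
rewrite fpsC_exp fpsCM fpsXnM /subst_zq /fps_dilate -exprM fpsXnM.
set d := (\sum_(p <- s) p.1)%N; set l' := (l - size s)%N.
(* A raised partition of length l has weight at least r l' + d; below that both coefficients
   vanish. *)
have [le_m|lt_m] := leqP (r * l' + d) m; last first.
  rewrite /gf (_ : level _ l m = set0) ?fset_set0 /=; last first.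
    apply/seteqP; split=> // lam [[mu _ ->]].
    rewrite plength_raise // pweight_raise // -/d => lE mE.
    have lenE : plength mu = l' by lia.
    by rewrite lenE in mE; lia.
  by do 2?case: ifP => //; lia.
rewrite !ifT; try lia.
pose m' := (m - d - r * l')%N.
transitivity ((#|` fset_set (raise f r s @` level A l' m') |)%:Z); last first.
  by rewrite fset_set_image ?card_imfset //=;
    [exact: raise_inj|exact: finite_level].
congr (_%:Z); congr (#|` fset_set _ |); apply/seteqP; split=> lam /=.
  case=> -[mu Amu ->]; rewrite plength_raise pweight_raise -/d => lE mE.
  have lenE : plength mu = l' by lia.
  by exists mu => //; split=> //; rewrite lenE in mE; lia.
case=> mu [Amu lE mE] <-; split; first by exists mu.
  by rewrite plength_raise lE subnK.
by rewrite pweight_raise lE mE -/d; lia.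
Qed.

End GeneratingFunctions.

(** * The classes of admissible partitions as images of raising *)

Section Classes.
Variable n : nat.
Hypothesis n_gt0 : (0 < n)%N.
Implicit Types (mu lam : {mset (nat * 'I_n)}%mset) (c : 'I_n).

Let c0 : 'I_n := Ordinal n_gt0.

Local Open Scope nat_scope.

Lemma admissible_last_row1 a k lam c : a <= k ->
  admissible (Lambda n 0 *+ (k - a) + Lambda n n *+ a)%R lam ->
  lam (1, c) <= a * (c == rev_ord c0).
Proof.
move=> leak /admissibleE[_]; rewrite sum_weightD !sum_LambdaMn // => bnd.
have -> : (c == rev_ord c0) = (c.+1 == n).
  by rewrite -val_eqE /=; have := ltn_ord c; lia.
apply: bounded_last_row1 bnd c => [c|c]; rewrite /= !weightE /= /bump /= ?add1n.
  by rewrite muln0.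
by lia.
Qed.

Lemma admissible_last_class a i k lam : i <= a -> a <= k ->
  admissible (Lambda n 0 *+ (k - a) + Lambda n n *+ a)%R lam
    /\ lam (1, rev_ord c0) = i
  <-> exists2 mu,
    admissible (Lambda n 0 *+ i + Lambda n 1 *+ (a - i) + Lambda n n *+ (k - a))%R mu
    & lam = raise (@rev_ord n) 1 (nseq i (1, rev_ord c0)) mu.
Proof.
move=> leia leak; split=> [[adm lam1]|[mu adm ->]].
  have [part_lam _] := adm.
  have [||mu part_mu lamE] := @raise_onto _ (@rev_ord n) 1
    (nseq i (1, rev_ord c0)) (@rev_ordK n) lam.
  - move=> [|[|x]] c // _; rewrite count_nseq /= ?partition_size0 //.
    rewrite xpair_eqE eqxx /= eq_sym.
    case: eqVneq => [->|nec]; first by rewrite mul1n.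
    have := admissible_last_row1 c leak adm.
    by rewrite (negbTE nec) muln0; case: (lam _).
  - by move=> p /nseqP[->].
  exists mu => //; rewrite lamE in adm.
  exact/(admissible_raise_last n_gt0 leia leak).
have [part_mu _] := adm; split; first by apply/admissible_raise_last.
rewrite raiseE ?partition_size0 //; last exact: rev_ordK.
by rewrite count_nseq /= eqxx mul1n.
Qed.

(** The forced bounds in terms of parts; the last clause confines the parts 2 to the first colour in
    the classes handled by two shifts. *)
Lemma admissible_first_low h lam :
  admissible (Lambda n 0 *+ h + Lambda n 1)%R lam ->
  [/\ forall c, lam (1, c) <= (c == c0), lam (2, c0) + lam (1, c0) <= h.+1
    & forall c, c != c0 ->
      (h < lam (2, c0)) || (lam (1, c0) == 1) -> lam (2, c) = 0].
Proof.
move=> /admissibleE[_].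
rewrite -{1}[Lambda n 1]mulr1n sum_weightD !sum_LambdaMn // addn1 => bnd.
set G := grid _ _ in bnd.
have c0E c : (c == c0) = (c == 0 :> nat) by [].
have G0 c : G 0 c = (c == 0 :> nat) by rewrite /G /= !weightE /= /bump /= add1n; lia.
have G1 c : G 1 c = h * (c == 0 :> nat) by rewrite /G /= !weightE /=; lia.
have G2 := bounded_first_row1 G0 G1 bnd.
have {}G2' c : G 2 c = G 2 c0 * (c == 0 :> nat).
  have [c_0|/negbTE ne] := eqVneq c c0; first by rewrite c_0 muln1.
  by have := G2 c; rewrite -c0E ne; lia.
split=> [c||c ne]; first exact: G2.
  by have [] := bounded_first_row2 G1 G2' bnd c0 (c0 := c0) erefl.
have [_] := bounded_first_row2 G1 G2' bnd c (c0 := c0) erefl.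
rewrite lt0n -c0E ne /G /= => /(_ isT) le1 /(_ isT) le2 /orP[]; lia.
Qed.

Lemma admissible_middle_class h lam :
  admissible (Lambda n 0 *+ h + Lambda n 1)%R lam
    /\ (lam (1, c0) == 0) && (lam (2, c0) <= h)
  <-> exists2 mu, admissible (Lambda n (n - 1) + Lambda n n *+ h)%R mu
    & lam = raise (@rev_ord n) 1 [::] mu.
Proof.
split=> [[adm /andP[/eqP lam1 lam2]]|[mu adm ->]].
  have [part_lam _] := adm; have [low1 _ _] := admissible_first_low adm.
  have [||mu part_mu lamE] := @raise_onto _ (@rev_ord n) 1 [::] (@rev_ordK n) lam.
  - move=> [|[|x]] c // _; rewrite /= ?partition_size0 //.
    by have := low1 c; case: eqVneq => [->|_]; rewrite ?lam1 //; case: (lam _).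
  - by [].
  exists mu => //; rewrite lamE in adm lam2.
  apply/(admissible_raise_middle n_gt0) => //; split=> //.
  by move: lam2; rewrite raiseE ?addn0 //; exact: rev_ordK.
have [part_mu _] := adm.
have [] := (admissible_raise_middle n_gt0 h part_mu).2 adm => ? ?; split=> //.
rewrite !raiseE; try exact: rev_ordK.
by rewrite !addn0 subn1 /= partition_size0.
Qed.

Lemma admissible_first_class h i lam : i <= h.+1 ->
  admissible (Lambda n 0 *+ h + Lambda n 1)%R lam
    /\ (lam (1, c0) = (i <= h) /\ lam (2, c0) = i)
  <-> exists2 mu, admissible (Lambda n 0 *+ i + Lambda n 1 *+ (h.+1 - i))%R mu
    & lam = raise id 2 (nseq (i <= h) (1, c0) ++ nseq i (2, c0)) mu.
Proof.
move=> leih; split=> [[adm [lam1 lam2]]|[mu adm ->]].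
  have [part_lam _] := adm; have [low1 _ low2] := admissible_first_low adm.
  have [||mu part_mu lamE] := @raise_onto _ id 2
    (nseq (i <= h) (1, c0) ++ nseq i (2, c0)) (fun _ => erefl) lam.
  - move=> [|[|[|x]]] c // _; rewrite count_cat !count_nseq /=.
    + by rewrite partition_size0.
    + rewrite !xpair_eqE /= addn0 eq_sym; case: eqVneq => [->|nec].
        by rewrite lam1 mul1n.
      by have := low1 c; rewrite (negbTE nec); case: (lam _).
    rewrite !xpair_eqE /= add0n eq_sym; case: eqVneq => [->|nec].
      by rewrite lam2 mul1n.
    by rewrite low2 // lam1 lam2; lia.
  - by move=> p; rewrite mem_cat => /orP[] /nseqP[->].
  by exists mu => //; rewrite lamE in adm; apply/(admissible_raise_first n_gt0).
have [part_mu _] := adm; split; first by apply/admissible_raise_first.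
rewrite !raiseE // !count_cat !count_nseq /=.
by rewrite !partition_size0 //; lia.
Qed.

End Classes.

(** * Summation over the classes *)

Theorem proposition3p2 (n : nat) (n_gt0 : (0 < n)%N) :
  (forall a k : nat, (a <= k)%N ->
     genfun (Lambda n 0 *+ (k - a) + Lambda n n *+ a)
     = \sum_(i < a.+1)
         (z * q) ^+ i
         * subst_zq 1 (genfun (Lambda n 0 *+ i + Lambda n 1 *+ (a - i)
                               + Lambda n n *+ (k - a))))
  /\
  (forall k : nat, (1 <= k)%N ->
     genfun (Lambda n 0 *+ (k - 1) + Lambda n 1)
     = subst_zq 1 (genfun (Lambda n (n - 1) + Lambda n n *+ (k - 1)))
       + (z * q ^+ 2) ^+ k * subst_zq 2 (genfun (Lambda n 0 *+ k))
       + z * q * \sum_(i < k)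
           (z * q ^+ 2) ^+ i
           * subst_zq 2 (genfun (Lambda n 0 *+ i + Lambda n 1 *+ (k - i)))).
Proof.
have genfunE k : genfun k = gf (@admissible n k) by [].
have partA k lam : @admissible n k lam -> is_partition lam by case.
have sum_nseq i (p : nat * 'I_n) : (\sum_(p <- nseq i p) p.1 = i * p.1)%N.
  by rewrite big_nseq iter_addn_0 mulnC.
split=> [a k leak|[//|h] _].
  (* An admissible partition has at most a parts 1 in the last colour, so [inord] loses nothing. *)
  rewrite genfunE (@gf_partition _ _
    (fun lam => inord (lam (1, rev_ord (Ordinal n_gt0)))%N : 'I_a.+1));
    last exact: partA.
  apply: eq_bigr => i _; have leia : (i <= a)%N by rewrite -ltnS.
  transitivity (gf (fun lam => exists2 mu,
     admissible (Lambda n 0 *+ i + Lambda n 1 *+ (a - i) + Lambda n n *+ (k - a)) mu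
     & lam = raise (@rev_ord n) 1 (nseq i (1%N, rev_ord (Ordinal n_gt0))) mu)).
    apply: eq_gf => lam; rewrite -admissible_last_class //.
    split=> -[adm lam1]; split=> //; last by rewrite lam1 inord_val.
    rewrite -lam1 inordK // ltnS.
    have := admissible_last_row1 n_gt0 (rev_ord (Ordinal n_gt0)) leak adm.
    by rewrite eqxx muln1.
  rewrite gf_raise; [|exact: rev_ordK|exact: partA].
  by rewrite size_nseq sum_nseq muln1 exprMn.
rewrite genfunE subn1 /=; pose c0 := Ordinal n_gt0.
rewrite (@gf_partition _ _
  (fun lam => (lam (1, c0) == 0) && (lam (2, c0) <= h))%N); last exact: partA.
rewrite big_bool /= -addrA; congr (_ + _).
  rewrite (eq_gf (admissible_middle_class n_gt0 h)) gf_raise;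
    [|exact: rev_ordK|exact: partA].
  by rewrite big_nil !mul1r.
(* The remaining partitions are classified by the number i of parts 2 in the first colour, at most h
   + 1 = k. *)
rewrite (@gf_partition _ _ (fun lam => inord (lam (2, c0))%N : 'I_h.+2));
  last by move=> lam [/partA].
have classE (i : 'I_h.+2) :
    gf (fun lam => (admissible (Lambda n 0 *+ h + Lambda n 1) lam
          /\ ((lam (1, c0) == 0) && (lam (2, c0) <= h))%N = false)
          /\ inord (lam (2, c0))%N = i)
    = z ^+ ((i <= h)%N + i) * q ^+ ((i <= h)%N + i * 2)
      * subst_zq 2 (genfun (Lambda n 0 *+ i + Lambda n 1 *+ (h.+1 - i))).
  have leih : (i <= h.+1)%N by rewrite -ltnS.
  rewrite (eq_gf (B := fun lam => exists2 mu,
     admissible (Lambda n 0 *+ i + Lambda n 1 *+ (h.+1 - i)) mu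
     & lam = raise id 2 (nseq (i <= h)%N (1, c0) ++ nseq i (2, c0))%N mu)).
    rewrite gf_raise //; last exact: partA.
    by rewrite size_cat !size_nseq big_cat /= !sum_nseq muln1.
  (* Outside the first class, i fixes the number of parts 1 in the first colour: one if i <= h, none
     if i = h + 1 by [low2]. *)
  move=> lam; rewrite -admissible_first_class //; split.
    case=> -[adm] cl lam2; split=> //.
    have [low1 low2 _] := admissible_first_low n_gt0 adm.
    have := low1 c0; rewrite eqxx => low1'.
    have lam2E : lam (2, c0)%N = i.
      by rewrite -lam2 inordK //; move: low2; rewrite -/c0; lia.
    by split=> //; move: cl low2; rewrite -/c0 lam2E; lia.
  case=> adm; rewrite -/c0 => -[lam1 lam2]; split; last by rewrite lam2 inord_val.
  by split=> //; rewrite lam1 lam2; lia.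
transitivity (\sum_(i < h.+2) z ^+ ((i <= h)%N + i) * q ^+ ((i <= h)%N + i * 2)
      * subst_zq 2 (genfun (Lambda n 0 *+ i + Lambda n 1 *+ (h.+1 - i)))).
  by apply: eq_bigr => i _; rewrite -classE.
(* The index i = h + 1 gives the term in [Lambda n 0 *+ k]; the others share the factor z q of their
   single part 1. *)
rewrite big_ord_recr /= ltnn subnn mulr0n addr0 !add0n addrC; congr (_ + _).
  by rewrite exprMn -exprM (mulnC 2).
rewrite mulr_sumr; apply: eq_bigr => i _.
rewrite -ltnS ltn_ord !exprD !expr1 exprMn -exprM (mulnC 2).
by rewrite [X in X * _ = _]mulrACA -[LHS]mulrA.
Qed.
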